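(* Let $P$ be a countable poset and let $X$ be $\mathrm{MF}(P)$ or $\mathrm{UF}(P)$. If $X$ is Hausdorff, then either $X$ has countably many points or $X$ contains a nonempty perfect closed set (a nonempty closed subset with no isolated points in the subspace topology).
   Context: A poset is a set $P$ with a reflexive, antisymmetric, transitive relation $\preceq$; $p\prec q$ means $p\preceq q$ and $p\neq q$. A filter on $P$ is a nonempty subset $F\subseteq P$ such that (1) for all $p,q\in F$ there is $r\in F$ with $r\preceq p$ and $r\preceq q$, and (2) if $p\in F$, $q\in P$ and $p\preceq q$ then $q\in F$. A filter $F$ is unbounded if there is no $r\in P$ with $r\prec q$ for every $q\in F$; it is maximal if no strictly larger filter contains it (every maximal filter is unbounded). $\mathrm{UF}(P)$ is the set of unbounded filters on $P$, with the topology having basis $\{N_p : p\in P\}$, where $N_p=\{F\in \mathrm{UF}(P) : p\in F\}$; $\mathrm{MF}(P)\subseteq \mathrm{UF}(P)$ is the set of maximal filters, with the subspace topology. ''Countable'' includes finite. *)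

(* Defs.v *)
From HB Require Import structures.
From mathcomp Require Import all_boot all_order.
From mathcomp Require Import all_classical all_analysis.

Set Implicit Arguments.
Unset Strict Implicit.
Unset Printing Implicit Defensive.

Import Order.TTheory.

Local Open Scope classical_set_scope.
Local Open Scope order_scope.

Section Filters.
Context (d : Order.disp_t) (P : porderType d).
Implicit Types F G : set P.

(* Order-theoretic filters on P: unlike [Filter] of MathComp-Analysis, these
   are sets of elements of P rather than sets of sets. *)
Definition pfilter F : Prop :=
  [/\ F !=set0,
      forall p q, F p -> F q -> exists r, [/\ F r, r <= p & r <= q] &
      forall p q, F p -> p <= q -> F q].

Definition unbounded_pfilter F : Prop :=
  pfilter F /\ ~ exists r : P, forall q, F q -> r < q.

Definition maximal_pfilter F : Prop :=
  pfilter F /\ ~ exists G, pfilter G /\ F `<` G.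

Lemma maximal_pfilter_unbounded F : maximal_pfilter F -> unbounded_pfilter F.
Proof.
move=> [Ff maxF]; split=> // -[r rF]; apply: maxF.
have [[p Fp] _ _] := Ff.
exists [set q | r <= q]; split.
- split; first by exists r => /=.
  + by move=> p' q' /= rp rq; exists r.
  + by move=> p' q' /= rp; exact: le_trans.
- split; first by move=> q /rF /ltW.
  by move=> /(_ r (lexx r)) /rF; rewrite ltxx.
Qed.

End Filters.

Definition UF (d : Order.disp_t) (P : porderType d) : Type :=
  set_type (@unbounded_pfilter d P).

HB.instance Definition _ (d : Order.disp_t) (P : porderType d) :=
  Choice.on (UF P).

Definition UF_nbhd (d : Order.disp_t) (P : porderType d) (p : P) :
  set (UF P) := [set F | set_val F p].

Section UFTopology.
Context (d : Order.disp_t) (P : porderType d).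

Let basic_cover :
  \bigcup_(U in range (@UF_nbhd d P)) id U = [set: UF P].
Proof.
apply/seteqP; split=> // F _.
have [[[p Fp] _ _] _] := set_valP F.
by exists (UF_nbhd p) => //; exists p.
Qed.

Let basic_join (U V : set (UF P)) (F : UF P) :
  range (@UF_nbhd d P) U -> range (@UF_nbhd d P) V -> id U F -> id V F ->
  exists W, [/\ range (@UF_nbhd d P) W, id W F & id W `<=` id U `&` id V].
Proof.
move=> [p _ <-] [q _ <-] /= Fp Fq.
have [[_ dirF _] _] := set_valP F.
have [r [Fr rp rq]] := dirF _ _ Fp Fq.
exists (UF_nbhd r); split=> //; first by exists r.
move=> G Gr; have [[_ _ upG] _] := set_valP G.
by split; [exact: upG rp | exact: upG rq].
Qed.

HB.instance Definition _ :=
  isBaseTopological.Build (UF P) basic_cover basic_join.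

Lemma UF_openP (U : set (UF P)) :
  open U <-> forall F, U F -> exists p : P, UF_nbhd p F /\ UF_nbhd p `<=` U.
Proof.
split=> [[D' D'sub <-] F [V D'V VF]|oU].
  have [p _ pV] := D'sub _ D'V; exists p.
  by rewrite pV; split=> // G VG; exists V.
exists [set V | range (@UF_nbhd d P) V /\ V `<=` U]; first by move=> V [].
apply/seteqP; split=> [F [V [_ VU] /VU //]|F /oU[p [Fp pU]]].
by exists (UF_nbhd p) => //; split=> //; exists p.
Qed.

End UFTopology.

(* [set_type] carries the topology induced by the inclusion, so that [MF P] is
   a topological subspace of [UF P]. *)
Definition MF (d : Order.disp_t) (P : porderType d) : topologicalType :=
  set_type [set F : UF P | maximal_pfilter (set_val F)].

(* Main.v *)
(* In a second countable space, the points without a countable neighbourhood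
   form a closed set K whose complement is a countable union of countable basic
   open sets (Cantor-Bendixson).  Every neighbourhood of a point of K is
   uncountable and meets the complement of K in a countable set, so K has no
   isolated point; and K is nonempty as soon as the space is uncountable.  For
   countable P, the sets N_p make UF(P) and its subspace MF(P) second
   countable. *)
Require Import Defs.
From mathcomp Require Import all_boot all_order.
From mathcomp Require Import all_classical all_analysis.

Local Open Scope classical_set_scope.

Definition condensation_points (T : topologicalType) : set T :=
  [set x | forall U, nbhs x U -> ~ countable U].

(** An open neighbourhood of a point of the closure is also a neighbourhood of some condensation
    point, hence uncountable. *)
Lemma closed_condensation_points (T : topologicalType) :
  closed (condensation_points T).
Proof.
move=> x clx U; rewrite nbhsE => -[V [oV Vx] VU].
have [y [Ky Vy]] := clx V (open_nbhs_nbhs (conj oV Vx)).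
move=> /(sub_countable (subset_card_le VU)); apply: Ky.
exact: open_nbhs_nbhs.
Qed.

Lemma countable_setC_condensation_points (T : topologicalType) :
  @second_countable T -> countable (~` condensation_points T).
Proof.
move=> [B cB [_ Bnbhs]].
have sub : ~` condensation_points T `<=`
    \bigcup_(U in [set U | B U /\ countable U]) U.
  move=> x /existsNP[U /not_implyP[xU /contrapT cU]].
  have [V [BV Vx] VU] := Bnbhs x U xU.
  exists V => //; split=> //; exact: sub_countable (subset_card_le VU) cU.
apply: sub_countable (subset_card_le sub) _.
apply: bigcup_countable => [|U []//].
by apply: sub_countable cB; apply: subset_card_le => U [].
Qed.

Lemma perfect_condensation_points (T : topologicalType) :
  @second_countable T -> perfect_set (condensation_points T).
Proof.
move=> scT; have clK := @closed_condensation_points T.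
(* [perfect_set] asks for equality with the set of limit points: closedness gives one inclusion, the
   absence of isolated points the other. *)
split=> //; apply/seteqP; split=> x; first by move=> /subset_limit_point/clK.
move=> Kx U xU; apply: contrapT => noy; apply: (Kx U xU).
(* With no condensation point in [U] other than [x], the set [U] would be countable. *)
have sub : U `<=` [set x] `|` ~` condensation_points T.
  move=> y Uy; have [->|yx] := eqVneq y x; first by left.
  by right=> Ky; apply: noy; exists y.
apply: sub_countable (subset_card_le sub) _.
(* [bigcup2] pads the two sets with empty ones, whence the third case. *)
rewrite -bigcup2E; apply: bigcup_countable => // -[|[|n]] _ /=.
- exact: countable1.
- exact: countable_setC_condensation_points.
- exact: countable0.
Qed.

Lemma second_countable_countable_or_perfect (T : topologicalType) :
  @second_countable T ->
  countable [set: T] \/ exists A : set T, A !=set0 /\ perfect_set A.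
Proof.
move=> scT; have [K0|/set0P K0] := eqVneq (condensation_points T) set0.
  left; rewrite -setC0 -K0; exact: countable_setC_condensation_points.
by right; exists (condensation_points T); split=> //;
  exact: perfect_condensation_points.
Qed.

(** The traces on [A] of a countable basis of [T] form a basis of the subspace. *)
Lemma second_countable_set_type (T : topologicalType) (A : set T) :
  @second_countable T -> @second_countable (set_type A).
Proof.
move=> [B cB [oB Bnbhs]].
exists [set set_val @^-1` U | U in B].
  exact: sub_countable (card_image_le _ _) cB.
split=> [_ [U BU <-]|x V]; first by exists U => //; exact: oB.
rewrite nbhsE => -[W [[W' oW' <-] W'x] WV].
have [U [BU Ux] UW'] := Bnbhs _ _ (open_nbhs_nbhs (conj oW' W'x)).
exists (set_val @^-1` U); first by split=> //; exists U.
by move=> y /UW' /WV.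
Qed.

Lemma second_countable_UF (d : Order.disp_t) (P : porderType d) :
  countable [set: P] -> @second_countable (UF P).
Proof.
move=> cP; exists (range (@UF_nbhd d P)).
  exact: sub_countable (card_image_le _ _) cP.
split=> [_ [p _ <-]|F U]; first by apply/UF_openP => F Fp; exists p; split.
rewrite nbhsE => -[V [/UF_openP oV /oV[p [Fp pV]]] VU].
exists (UF_nbhd p); last exact: subset_trans VU.
by split=> //; exists p.
Qed.

Theorem corollary8p2 (d : Order.disp_t) (P : porderType d)
    (cP : countable [set: P]) :
  (hausdorff_space (MF P) ->
     countable [set: MF P] \/
     exists A : set (MF P), A !=set0 /\ perfect_set A) /\
  (hausdorff_space (UF P) ->
     countable [set: UF P] \/
     exists A : set (UF P), A !=set0 /\ perfect_set A).
Proof.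
have scUF := @second_countable_UF d P cP.
split=> _; apply: second_countable_countable_or_perfect => //.
(* [MF P] is by definition a [set_type] over [UF P]. *)
exact: second_countable_set_type.
Qed.
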